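(* Let $\delta_0>0$ be a sufficiently small constant and $d_0=\lfloor\delta_0\ln n\rfloor$. Let $\tilde G=(G_i)_{i=0}^N$ be a random graph process on $n$ vertices, and let $G=G_{\tau_2}$, where $\tau_2=\tau_2(\tilde G)$ is the hitting time for having minimum degree at least $2$. Then with probability tending to $1$ as $n\to\infty$, the following holds: for every $(n/4,2)$-expander $\Gamma\subseteq G$ with $V(\Gamma)=V(G)$ and $|E(\Gamma)|\le d_0n+n$, either $\Gamma$ is Hamiltonian or $G$ contains at least one booster with respect to $\Gamma$ (i.e., an edge of $G$ that is a booster of $\Gamma$).
   Context: Let $N=\binom n2$. A random graph process on $n$ vertices is obtained by choosing a uniformly random ordering $(e_1,\dots,e_N)$ of the edges of $K_n$ on vertex set $[n]$ and letting $G_i$ be the graph on $[n]$ with edge set $\{e_1,\dots,e_i\}$; the hitting time of a monotone increasing property is the least $i$ such that $G_i$ has it. For a positive integer $k$ and a positive real $\alpha$, a graph $\Gamma=(V,E)$ is a $(k,\alpha)$-expander if $|N_\Gamma(U)|\ge\alpha|U|$ for every $U\subset V$ with $|U|\le k$, where $N_\Gamma(U)=\{v\in V\setminus U: v\text{ has a neighbor in }U\}$. Given a graph $\Gamma$, a non-edge $e$ of $\Gamma$ is a booster if adding $e$ to $\Gamma$ creates a graph which is Hamiltonian or whose longest path is longer than that of $\Gamma$. *)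

(* Defs.v *)
From HB Require Import structures.
From mathcomp Require Import all_boot all_order all_algebra.

Set Implicit Arguments.
Unset Strict Implicit.
Unset Printing Implicit Defensive.

Import Order.TTheory GRing.Theory Num.Theory.

(* A simple graph with vertex set V (a finType) is its set of edges, an edge
   being a two-element subset of V. *)
Record edge (V : finType) := Edge {ends :> {set V}; _ : #|ends| == 2}.

HB.instance Definition _ (V : finType) := [isSub for @ends V].
HB.instance Definition _ (V : finType) := [Finite of edge V by <:].

Notation graph V := {set edge V}.

Section Graphs.
Variable V : finType.
Implicit Types (Gamma : graph V) (U : {set V}) (e : edge V).

Definition adj Gamma : rel V :=
  fun u v => [exists e in Gamma, ends e == [set u; v]].

Definition degree Gamma (v : V) : nat := #|[set u | adj Gamma v u]|.

Definition min_degree_ge (d : nat) Gamma : bool :=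
  [forall v, d <= degree Gamma v].

Definition neighbourhood Gamma U : {set V} :=
  [set v in ~: U | [exists u in U, adj Gamma v u]].

(* The size bound k is a real number, so that k = n/4 makes sense for all n. *)
Definition expander (R : realFieldType) (k alpha : R) Gamma : bool :=
  [forall U : {set V}, (#|U|%:R <= k)%R ==>
    (alpha * #|U|%:R <= #|neighbourhood Gamma U|%:R)%R].

Definition hamiltonian Gamma : bool :=
  (3 <= #|V|) && [exists c : #|V|.-tuple V, cycle (adj Gamma) c && uniq c].

Definition has_path_of_length Gamma (l : nat) : bool :=
  [exists x : V, exists p : l.-tuple V, path (adj Gamma) x p && uniq (x :: p)].

(* Length counts edges; a path in Gamma has at most #|V| - 1 of them. *)
Definition longest_path Gamma : nat :=
  \max_(l < #|V| | has_path_of_length Gamma l) l.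

Definition booster Gamma e : bool :=
  (e \notin Gamma) &&
  (hamiltonian (e |: Gamma) || (longest_path Gamma < longest_path (e |: Gamma))).

End Graphs.

Lemma card_edge (V : finType) : #|{: edge V}| = 'C(#|V|, 2).
Proof.
rewrite -(card_imset predT (@val_inj _ _ (edge V))) -(card_draws V 2).
apply: eq_card => A; rewrite inE; apply/imsetP/idP => [[e _ ->]|cA].
  exact: (valP e).
by exists (Edge cA).
Qed.

(* A duplicate-free sequence of 'C(n, 2) edges of K_n lists all of them, by
   card_edge. *)
Record ordering (n : nat) :=
  Ordering {edge_seq :> 'C(n, 2).-tuple (edge 'I_n); _ : uniq edge_seq}.

HB.instance Definition _ (n : nat) := [isSub for @edge_seq n].
HB.instance Definition _ (n : nat) := [Finite of ordering n by <:].

Lemma mem_ordering (n : nat) (w : ordering n) (e : edge 'I_n) :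
  e \in edge_seq w.
Proof.
have cw : #|edge_seq w| = #|{: edge 'I_n}|.
  by rewrite (card_uniqP (valP w)) size_tuple card_edge card_ord.
by rewrite (subset_cardP cw (subset_predT _)).
Qed.

Lemma card_ordering_gt0 (n : nat) : 0 < #|{: ordering n}|.
Proof.
have sz : size (enum {: edge 'I_n}) == 'C(n, 2).
  by rewrite -cardE card_edge card_ord.
by apply/card_gt0P; exists (@Ordering n (Tuple sz) (enum_uniq _)).
Qed.

Definition process (n : nat) (w : ordering n) (i : nat) : graph 'I_n :=
  [set e in take i w].

(* The least i in {0, ..., N} such that G_i satisfies P, with N = 'C(n, 2);
   it is N.+1 if there is none. *)
Definition hitting_time (n : nat) (P : pred (graph 'I_n)) (w : ordering n) :
  nat := find (fun i => P (process w i)) (iota 0 'C(n, 2).+1).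

Definition equiprob (R : realFieldType) (T : finType) (A : pred T) : R :=
  (#|A|%:R / #|T|%:R)%R.

(* Main.v *)
Require Import Defs.
From HB Require Import structures.
From mathcomp Require Import all_boot all_order all_algebra.
From mathcomp Require Import zify ring lra boolp.

Set Implicit Arguments.
Unset Strict Implicit.
Unset Printing Implicit Defensive.

Import Order.TTheory GRing.Theory Num.Theory.

(* Let N = 'C(n, 2).  By Posa's rotation argument, a non-Hamiltonian expander
   Gamma has at least n^2/32 >= N/16 boosters: a longest path has more than n/4
   endpoints reachable by rotations, each of these starts a longest path with
   more than n/4 such endpoints, and joining the two ends of a longest path
   gives a booster because Gamma is connected.

   The graph G_m is uniform among the graphs with m edges.  For a fixed Gamma
   with k edges, G_m contains Gamma and misses its boosters with probability at
   most (15/16)^(m-k) P(Gamma \subset G_m), so that the union bound over all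
   Gamma with k <= K edges gives
     \sum_(k <= K) 'C(m, k) (15/16)^(m-k) <= 32^K (31/32)^m,
   which is at most (63/64)^m when m >= 310 K.  This is summable over m.

   It remains to see that the hitting time is at least m = 310 K with high
   probability when K is a small multiple of n ln n.  Isolation of two distinct
   vertices in G_m is negatively correlated because N <= (n-1)^2, hence
   Chebyshev's inequality bounds the probability that G_m has no isolated
   vertex by the inverse of the expected number of isolated vertices, which is
   at least n exp(-8m/n) >= sqrt n. *)

(** * Rotations and boosters *)

Section Rotation.
Variables (V : finType) (e : rel V).
Hypothesis e_sym : symmetric e.

(** The path is [s :: p] with [s] kept fixed; a step joins the far end to the pivot [last s q1] and
    reverses what follows the pivot. *)
Inductive rotation (s : V) (p : seq V) : seq V -> Prop :=
| rotation_refl : rotation s p p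
| rotation_step q1 q2 : rotation s p (q1 ++ q2) ->
    e (last s (q1 ++ q2)) (last s q1) -> rotation s p (q1 ++ rev q2).

Definition rotation_ends (s : V) (p : seq V) : {set V} :=
  [set u | `[< exists2 q, rotation s p q & last s q = u >]].

Lemma rotation_endsP s p u :
  reflect (exists2 q, rotation s p q & last s q = u) (u \in rotation_ends s p).
Proof. by rewrite inE; apply: asboolP. Qed.

Lemma rotation_perm s p q : rotation s p q -> perm_eq p q.
Proof.
elim=> [|q1 q2 _ IH _] //; apply: perm_trans IH _.
by rewrite perm_cat2l perm_sym perm_rev.
Qed.

Lemma rotation_uniq s p q : rotation s p q -> uniq (s :: q) = uniq (s :: p).
Proof.
by move=> rq; apply: perm_uniq; rewrite perm_cons perm_sym (rotation_perm rq).
Qed.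

(** The relation [r] is arbitrary because this serves both the graph and the auxiliary relation in
    [posa]. *)
Lemma path_rotation_step (r : rel V) s q1 q2 : symmetric r ->
  path r s (q1 ++ q2) -> (q2 != [::] -> r (last s q1) (last s (q1 ++ q2))) ->
  path r s (q1 ++ rev q2).
Proof.
move=> r_sym; rewrite !cat_path last_cat => /andP[-> /=].
case: q2 => [|y t] //= /andP[_ pt] /(_ isT) rx.
rewrite lastI rev_rcons /= rx /= rev_path.
by rewrite (eq_path (e' := r)) // => a b; rewrite r_sym.
Qed.

Lemma rotation_path s p q : path e s p -> rotation s p q -> path e s q.
Proof.
move=> pP; elim=> [|q1 q2 _ IH eq] //; apply: path_rotation_step => // _.
by rewrite e_sym.
Qed.

(** Every outside neighbour of the set [R] of ends is next to a member of [R] on the original path.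
    The last vertex is in [R] and has no successor there, which leaves at most [(|R| - 1) + |R|]
    such neighbours. *)
Lemma posa s p : path e s p -> uniq (s :: p) ->
  (forall s' p', path e s' p' -> uniq (s' :: p') -> size p' <= size p) ->
  #|[set v in ~: rotation_ends s p | [exists u in rotation_ends s p, e v u]]|
    < 2 * #|rotation_ends s p|.
Proof.
move=> pP pU pmax; set R := rotation_ends s p.
pose z := last s p.
pose succ := next (s :: p).
(* [next] is cyclic; the conditions [!= z] discard the step from the last vertex back to [s]. *)
pose link a b := (b == succ a) && (a != z) || (a == succ b) && (b != z).
have link_sym : symmetric link by move=> a b; rewrite /link orbC.
have link_path : path link s p.
  apply/(pathP s) => i ip; rewrite /link /succ next_nth.
  have iin : nth s (s :: p) i \in s :: p by rewrite mem_nth //= ltnW.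
  rewrite iin index_uniq //=; last by rewrite ltnW.
  rewrite eqxx /= /z (last_nth s) nth_uniq //=; last by rewrite ltnW.
  by rewrite ltn_eqF.
pose Nbr := [set v | [exists w in R, link v w]].
pose r a b := (a \in R :|: Nbr) && (b \in R :|: Nbr) || link a b.
have r_sym : symmetric r by move=> a b; rewrite /r andbC link_sym.
(* A rotation changes the path only at its old end, its new end (both in R) and
   the pivot; a pivot still joined to the new end by a link of the original path
   lies in Nbr.  So outside R :|: Nbr all links remain those of the original
   path. *)
have invariant q : rotation s p q -> path r s q.
  elim=> [|q1 q2 rq IH eq].
    by apply: sub_path link_path => a b; rewrite /r => ->; rewrite orbT.
  apply: path_rotation_step => //.
  case: q2 rq IH eq => [|y t] // rq IH eq _.
  have uR : last s (q1 ++ y :: t) \in R.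
    by apply/rotation_endsP; exists (q1 ++ y :: t).
  have yR : y \in R.
    apply/rotation_endsP; exists (q1 ++ rev (y :: t)).
      exact: rotation_step.
    by rewrite last_cat rev_cons last_rcons.
  rewrite /r [last s (q1 ++ _) \in _]in_setU uR andbT.
  suff -> : last s q1 \in R :|: Nbr by [].
  move: IH; rewrite cat_path /= => /and3P[_ + _].
  rewrite /r => /orP[/andP[-> _] //|lxy].
  by rewrite !inE; apply/orP; right; apply/existsP; exists y; rewrite yR.
have zR : z \in R by apply/rotation_endsP; exists p => //; apply: rotation_refl.
suff sub : [set v in ~: R | [exists u in R, e v u]] \subset
    (succ @: (R :\ z)) :|: (prev (s :: p) @: R).
  apply: leq_ltn_trans (subset_leq_card sub) _.
  apply: leq_ltn_trans (leq_card_setU _ _) _.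
  have := leq_imset_card succ (R :\ z).
  have := leq_imset_card (prev (s :: p)) R.
  have := cardsD1 z R; rewrite zR /=; lia.
apply/subsetP => v; rewrite in_set in_setC in_setU.
move=> /andP[vR /existsP[u /andP[uR evu]]].
suff : v \in Nbr.
  rewrite inE => /existsP[w /andP[wR]]; rewrite /link.
  move=> /orP[/andP[/eqP E nz]|/andP[/eqP E nz]].
    apply/orP; right; apply/imsetP; exists w => //.
    by rewrite E /succ prev_next.
  by apply/orP; left; apply/imsetP; exists w; rewrite // in_setD1 nz.
have /rotation_endsP[q rq qu] := uR.
(* A neighbour off the path [q] would extend it past the maximal length. *)
have vq : v \in s :: q.
  apply: contraT => vq.
  have := pmax s (rcons q v).
  rewrite size_rcons (perm_size (rotation_perm rq)) ltnn => -> //.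
    by rewrite rcons_path (rotation_path pP rq) qu e_sym.
  by rewrite -rcons_cons rcons_uniq vq (rotation_uniq rq).
move: rq qu; case/splitPl: q / vq => q1 q2 lq1 rq qu.
case: q2 => [|y t] in rq qu *.
  by rewrite cats0 in qu; rewrite -lq1 qu uR in vR.
(* Rotating at the pivot [v] turns its successor [y] into an end. By the invariant, [v] is then in
   [Nbr] already or linked to [y] in the original path. *)
have yR : y \in R.
  apply/rotation_endsP; exists (q1 ++ rev (y :: t)).
    by apply: rotation_step; rewrite // qu lq1 e_sym.
  by rewrite last_cat rev_cons last_rcons.
have := invariant _ rq; rewrite cat_path /= lq1 => /and3P[_ + _].
rewrite /r => /orP[/andP[+ _]|lvy].
  by rewrite in_setU (negbTE vR).
by rewrite inE; apply/existsP; exists y; rewrite yR.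
Qed.

End Rotation.

(** * Boosters of expanders *)

Section Boosters.
Variable V : finType.
Implicit Types (Gamma : graph V) (U : {set V}) (e : edge V).

Lemma adj_sym Gamma : symmetric (adj Gamma).
Proof. by move=> u v; rewrite /adj setUC. Qed.

Lemma sub_adj Gamma Gamma' : Gamma \subset Gamma' ->
  subrel (adj Gamma) (adj Gamma').
Proof.
move=> /subsetP sG u v /existsP[e /andP[eG ee]].
by apply/existsP; exists e; rewrite sG.
Qed.

Lemma leq_longest_path Gamma x p :
  path (adj Gamma) x p -> uniq (x :: p) -> size p <= longest_path Gamma.
Proof.
move=> pP pU.
have szp : size p < #|V| by have := max_card [in x :: p]; rewrite (card_uniqP pU).
pose i := Ordinal szp.
apply: (@leq_bigmax_cond _ _ (fun l : 'I_#|V| => l : nat) i).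
apply/existsP; exists x; apply/existsP; exists (in_tuple p).
exact/andP.
Qed.

Lemma longest_path_witness Gamma : 0 < #|V| -> exists x p,
  [/\ path (adj Gamma) x p, uniq (x :: p) & size p = longest_path Gamma].
Proof.
move=> V0; have /card_gt0P[x0 _] := V0.
have : 0 < #|[pred l : 'I_#|V| | has_path_of_length Gamma l]|.
  apply/card_gt0P; exists (Ordinal V0).
  by apply/existsP; exists x0; apply/existsP; exists [tuple].
move=> /(eq_bigmax_cond (fun l : 'I_#|V| => l : nat))[l].
rewrite inE => /existsP[x /existsP[p /andP[pP pU]]] E.
by exists x, p; rewrite size_tuple /longest_path E.
Qed.

(** Connectedness, phrased by cuts: this is what expansion yields and what lets a path leave a
    cycle. *)
Definition crossing Gamma := forall S : {set V}, S != set0 -> S != setT ->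
  exists x y, [/\ x \in S, y \notin S & adj Gamma y x].

(** If the cycle does not span, some edge leaves it; opening the cycle where that edge is attached
    gives a path with [size c] edges. *)
Lemma cycle_improves Gamma c : 3 <= #|V| -> crossing Gamma ->
  cycle (adj Gamma) c -> uniq c -> c != [::] ->
  hamiltonian Gamma || (size c <= longest_path Gamma).
Proof.
move=> V3 cr cC cU c0.
have [/eqP szc|szc] := eqVneq (size c) #|V|.
  by rewrite /hamiltonian V3; apply/orP; left; apply/existsP;
     exists (Tuple szc); rewrite /= cC.
apply/orP; right.
have [||x [y [xc yc a]]] := cr [set x in c].
- case: c c0 {cC cU szc} => // x c _; apply/set0Pn; exists x.
  by rewrite !inE eqxx.
- apply: contraNneq szc => cT; rewrite -cardsT -cT -(card_uniqP cU).
  by apply/eqP/eq_card => x; rewrite inE.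
rewrite inE in xc; rewrite inE in yc.
have [i c' rc] := rot_to xc.
have szc' : size c = size (x :: c') by rewrite -rc size_rot.
rewrite szc'; apply: (@leq_longest_path _ y).
  have := cC; rewrite -(rot_cycle i) rc /= rcons_path => /andP[-> _].
  by rewrite a.
by rewrite cons_uniq -rc mem_rot yc rot_uniq.
Qed.

Definition expanding Gamma := forall U : {set V}, 4 * #|U| <= #|V| ->
  2 * #|U| <= #|neighbourhood Gamma U|.

(** Take the side [T] with at most half of the vertices. A set [T'] of size [min(|T|, floor(n/4))]
    inside [T] has at least [2|T'|] neighbours, more than fit into [T] minus [T'], since
    [n/2 < 3 floor(n/4)] for [n > 9]. *)
Lemma expanding_crossing Gamma : 9 < #|V| -> expanding Gamma -> crossing Gamma.
Proof.
move=> V9 ex S S0 ST.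
suff half T : T != set0 -> 2 * #|T| <= #|V| ->
    exists x y, [/\ x \in T, y \notin T & adj Gamma y x].
  have [le|gt] := leqP (2 * #|S|) #|V|; first exact: half.
  have [||x [y [xS yS a]]] := half (~: S).
  - by apply: contraNneq ST => E; rewrite -[S]setCK E setC0.
  - by have := cardsC S; lia.
  - by exists y, x; rewrite !inE negbK in xS yS *; rewrite adj_sym.
move=> T0 leT.
suff [T' sT ltT] : exists2 T' : {set V}, T' \subset T &
    #|T :\: T'| < #|neighbourhood Gamma T'|.
  have /subsetPn[y] : ~~ (neighbourhood Gamma T' \subset T :\: T').
    by apply: contraTN ltT => /subset_leq_card; rewrite -leqNgt.
  rewrite !inE => /andP[yT' /existsP[x /andP[xT' a]]]; rewrite yT' /= => yT.
  by exists x, y; split; rewrite // (subsetP sT).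
have T1 : 0 < #|T| by rewrite card_gt0.
have [small|big] := leqP (4 * #|T|) #|V|.
  exists T => //; rewrite setDv cards0; have := ex _ small; lia.
have : 0 < #|[set T' : {set V} | T' \subset T & #|T'| == #|V| %/ 4]|.
  by rewrite cards_draws bin_gt0; lia.
case/card_gt0P => T'; rewrite inE => /andP[sT /eqP cT].
exists T' => //; have := ex T'.
rewrite cardsD (setIidPr sT) cT; lia.
Qed.

Lemma longest_path_gt0 Gamma : 1 < #|V| -> crossing Gamma ->
  0 < longest_path Gamma.
Proof.
move=> V1 cr; have /card_gt0P[x _] := ltnW V1.
have [||x' [y [/set1P-> yx a]]] := cr [set x].
- by apply/set0Pn; exists x; rewrite inE.
- by apply: contraTneq V1 => E; rewrite -cardsT -E cards1.
by apply: (@leq_longest_path _ y [:: x]); rewrite /= ?a // inE -in_set1 yx.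
Qed.

Lemma longest_path_ends_booster Gamma u p : 2 < #|V| -> crossing Gamma ->
  ~~ hamiltonian Gamma -> path (adj Gamma) u p -> uniq (u :: p) ->
  size p = longest_path Gamma ->
  exists2 e, booster Gamma e & ends e = [set u; last u p].
Proof.
move=> V3 cr nH pP pU szp; set w := last u p.
have uw : u != w.
  have : 0 < size p by rewrite szp longest_path_gt0 // ltnW.
  rewrite /w; case/lastP: p {pP szp w} pU => // p y.
  by rewrite last_rcons /= mem_rcons inE negb_or => /andP[/andP[]].
have c2 : #|[set u; w]| == 2 by rewrite cards2 uw.
pose e := Edge c2.
(* Used twice: for [Gamma] itself it shows that [e] is a non-edge, for [e |: Gamma] that [e] is a
   booster. *)
have improves Gamma' : Gamma \subset Gamma' -> e \in Gamma' ->
    hamiltonian Gamma' || (longest_path Gamma < longest_path Gamma').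
  move=> sG eG; rewrite -szp; apply: (@cycle_improves _ (u :: p)) => //.
    move=> S S0 ST; have [x [y [xS yS a]]] := cr S S0 ST.
    by exists x, y; rewrite (sub_adj sG).
  rewrite /= rcons_path (sub_path (sub_adj sG)) //=.
  by apply/existsP; exists e; rewrite eG /= setUC.
exists e => //; rewrite /booster.
have eG : e \notin Gamma.
  apply/negP => eG; have := improves Gamma (subxx _) eG.
  by rewrite (negbTE nH) ltnn.
by rewrite eG improves ?subsetUr // setU11.
Qed.

Lemma card_rotation_ends Gamma s p : expanding Gamma ->
  path (adj Gamma) s p -> uniq (s :: p) -> size p = longest_path Gamma ->
  #|V| < 4 * #|rotation_ends (adj Gamma) s p|.
Proof.
move=> ex pP pU szp; rewrite ltnNge; apply/negP => /ex.
rewrite leqNgt posa //; first exact: adj_sym.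
by move=> s' p' p'P p'U; rewrite szp; apply: leq_longest_path p'U.
Qed.

Lemma sum_degree Gamma : \sum_u degree Gamma u <= 2 * #|Gamma|.
Proof.
apply: (@leq_trans (\sum_u \sum_(e in Gamma) (u \in ends e))).
  apply: leq_sum => u _; rewrite -big_mkcondr sum1_card /=.
  rewrite /degree -(card_imset _ set1_inj).
  apply: (@leq_trans #|[set ends e :\ u | e in Gamma & u \in ends e]|);
    last by rewrite (leq_trans (leq_imset_card _ _)) // subset_leq_card //;
            apply/subsetP => e; rewrite !inE.
  apply/subset_leq_card/subsetP => _ /imsetP[w + ->].
  rewrite inE => /existsP[e /andP[eG /eqP ee]].
  apply/imsetP; exists e; first by rewrite !inE eG ee !inE eqxx.
  have := valP e; rewrite /= ee cards2 eqSS eqb1 => uw.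
  by apply/setP => x; rewrite !inE; have [->|//] := eqVneq x u; rewrite (negbTE uw).
rewrite exchange_big /= mulnC -sum_nat_const leq_sum // => e _.
rewrite -(eqP (valP e)) /= -sum1_card [leqRHS]big_mkcond /=.
by apply: leq_sum => u _; case: (u \in ends e).
Qed.

Lemma card_boosters Gamma : 9 < #|V| -> expanding Gamma ->
  ~~ hamiltonian Gamma -> #|V| ^ 2 <= 32 * #|[set e | booster Gamma e]|.
Proof.
move=> V9 ex nH; set B := [set e | _].
have cr := expanding_crossing V9 ex.
have [s [p [pP pU szp]]] := @longest_path_witness Gamma (leq_trans (isT : 0 < 10) V9).
have R0 := card_rotation_ends ex pP pU szp.
have deg u : u \in rotation_ends (adj Gamma) s p -> #|V| <= 4 * degree B u.
  move=> /rotation_endsP[q rq qu].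
  (* Read backwards, the path starts at [u]; rotating its other end supplies more than [n/4] booster
     partners of [u]. *)
  pose q' := rev (belast s q).
  have perm_q' : perm_eq (u :: q') (s :: q).
    by rewrite -qu -rev_rcons -lastI perm_rev.
  have q'P : path (adj Gamma) u q'.
    rewrite -qu rev_path (eq_path (e' := adj Gamma)) => [|a b].
      exact: (rotation_path (adj_sym Gamma) pP rq).
    exact: adj_sym.
  have q'U : uniq (u :: q') by rewrite (perm_uniq perm_q') (rotation_uniq rq).
  have szq' : size q' = longest_path Gamma.
    by rewrite size_rev size_belast -(perm_size (rotation_perm rq)).
  have /ltnW/leq_trans := card_rotation_ends ex q'P q'U szq'; apply.
  rewrite leq_mul2l /=; apply/subset_leq_card/subsetP => w.
  case/rotation_endsP => t rt <-; rewrite inE.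
  have [|||e eB ee] :=
    @longest_path_ends_booster Gamma u t (leq_trans (isT : 2 < 10) V9) cr nH.
  - exact: (rotation_path (adj_sym Gamma) q'P rt).
  - by rewrite (rotation_uniq rt).
  - by rewrite -(perm_size (rotation_perm rt)).
  by apply/existsP; exists e; rewrite inE eB ee eqxx.
(* Double counting over the set [R] of ends: [|R| n <= 8 |B|], to be combined with [n < 4 |R|]. *)
have : #|rotation_ends (adj Gamma) s p| * #|V| <= 4 * (2 * #|B|).
  apply: leq_trans (leq_mul (leqnn 4) (sum_degree B)).
  rewrite -sum_nat_const big_distrr /=.
  rewrite [leqRHS](bigID [in rotation_ends (adj Gamma) s p]) /=.
  by apply: leq_trans (leq_addr _ _); apply: leq_sum => u /deg.
nia.
Qed.

End Boosters.

(** * The graphs of the process *)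

Section Uniformity.

Lemma exists_inj_imset (T : finType) (A B : {set T}) : #|A| = #|B| ->
  exists2 f : T -> T, injective f & f @: A = B.
Proof.
move=> cAB; pose s (C : {set T}) := enum C ++ enum (~: C).
have sU C : uniq (s C).
  rewrite cat_uniq !enum_uniq /= andbT; apply/hasPn => x.
  by rewrite !mem_enum inE.
have sT C x : x \in s C by rewrite mem_cat !mem_enum inE orbN.
have szs : size (s A) = size (s B).
  by rewrite !size_cat -!cardE !cardsC.
have ltx x : index x (s A) < size (s B) by rewrite -szs index_mem.
pose f x := nth x (s B) (index x (s A)).
have f_inj : injective f.
  move=> x y; rewrite /f (set_nth_default y) // => /eqP.
  by rewrite nth_uniq // => /eqP /(congr1 (nth x (s A))); rewrite !nth_index.
exists f => //; apply/eqP; rewrite eqEcard card_imset // cAB leqnn andbT.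
apply/subsetP => _ /imsetP[x xA ->].
have ltA : index x (s A) < size (enum B).
  by rewrite -cardE -cAB cardE index_cat mem_enum xA index_mem mem_enum.
by rewrite /f nth_cat ltA -mem_enum mem_nth.
Qed.

Variable n : nat.
Implicit Types (w : ordering n) (A B : graph 'I_n).

Lemma card_process w m : m <= 'C(n, 2) -> #|process w m| = m.
Proof.
move=> mN; rewrite /process cardsE (card_uniqP _) ?take_uniq ?(valP w) //.
by rewrite size_takel // size_tuple.
Qed.

Lemma sub_process w i j : i <= j -> process w i \subset process w j.
Proof.
move=> ij; apply/subsetP => e; rewrite !inE => ei.
by rewrite -(take_takel _ ij) in ei; apply: mem_take ei.
Qed.

(** Relabelling the edges by a bijection that carries [A] to [B] acts injectively on orderings. *)
Lemma leq_card_process A B m : #|A| = #|B| ->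
  #|[set w | process w m == A]| <= #|[set w | process w m == B]|.
Proof.
move=> /exists_inj_imset[f f_inj fA].
have fU w : uniq (map_tuple f (edge_seq w)) by rewrite map_inj_uniq // (valP w).
pose F w := Ordering (fU w).
have F_inj : injective F.
  move=> w1 w2 /(congr1 (fun w => val (edge_seq w))) /(inj_map f_inj) E.
  exact/val_inj/val_inj.
rewrite -(card_imset _ F_inj); apply/subset_leq_card/subsetP => _ /imsetP[w + ->].
rewrite !inE => /eqP wA; rewrite -fA -wA; apply/eqP/setP => e.
rewrite inE /= -map_take.
by apply/mapP/imsetP => -[x xw ->]; exists x => //; move: xw; rewrite inE.
Qed.

(** Each graph with [m] edges is reached at time [m] by the same number [f0] of orderings, so [f0]
    cancels. *)
Lemma equiprob_process (F : realFieldType) (P : pred (graph 'I_n)) m :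
  m <= 'C(n, 2) ->
  equiprob F (fun w : ordering n => P (process w m)) =
  (#|[set A | P A & #|A| == m]|%:R / 'C('C(n, 2), m)%:R)%R.
Proof.
move=> mN; have /card_gt0P[w0 _] := card_ordering_gt0 n.
pose f0 := #|[set w | process w m == process w0 m]|.
have f0E A : #|A| = m -> #|[set w | process w m == A]| = f0.
  by move=> cA; apply/eqP; rewrite eqn_leq !leq_card_process // cA card_process.
have count (Q : pred (graph 'I_n)) :
    #|fun w : ordering n => Q (process w m)| = #|[set A | Q A & #|A| == m]| * f0.
  rewrite -[LHS]sum1_card (partition_big (fun w => process w m)
    [in [set A | Q A & #|A| == m]]) /=; last first.
    by move=> w Qw; rewrite inE card_process // eqxx andbT.
  rewrite -sum_nat_const; apply: eq_bigr => A; rewrite inE => /andP[QA /eqP cA].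
  rewrite -(f0E A cA) -sum1_card; apply: eq_bigl => w; rewrite !inE.
  by rewrite unfold_in; case: eqP => [->|]; rewrite ?QA ?andbF.
have f0_gt0 : 0 < f0 by apply/card_gt0P; exists w0; rewrite inE.
have total : #|{: ordering n}| = 'C('C(n, 2), m) * f0.
  rewrite (_ : #|_| = #|fun w : ordering n => predT (process w m)|);
    last exact: eq_card.
  rewrite count; congr (_ * _).
  have <- : #|[set: edge 'I_n]| = 'C(n, 2) by rewrite cardsT card_edge card_ord.
  by rewrite -cards_draws; apply: eq_card => A; rewrite !inE subsetT.
rewrite /equiprob count total !natrM -mulf_div divff ?mulr1 //.
by rewrite pnatr_eq0 -lt0n.
Qed.

End Uniformity.

(** * Chebyshev's inequality for uniform [m]-subsets *)

Section SecondMoment.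
Variables (T V : finType) (I : V -> {set T}) (s m : nat).
Hypothesis card_I : forall u, #|I u| = s.
Hypothesis card_IU : forall u v, u != v -> 2 * s <= #|I u :|: I v|.+1.
Hypothesis small_T : #|T| <= s ^ 2.

Lemma card_draws_disjoint (S : {set T}) :
  #|[set A : {set T} | [disjoint A & S] & #|A| == m]| = 'C(#|T| - #|S|, m).
Proof.
rewrite -(cardsC S) addKn -cards_draws; apply: eq_card => A.
by rewrite !inE disjoints_subset.
Qed.

(* The negative correlation of avoiding two sets of size s sharing one point:
   (x - 2s + 1) x <= (x - s)^2 as soon as x <= s^2. *)
Lemma bin_log_concave N : N <= s ^ 2 ->
  'C(N.+1 - 2 * s, m) * 'C(N, m) <= 'C(N - s, m) ^ 2.
Proof.
move=> Ns; elim: m => [|k IH]; first by rewrite !bin0.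
have [z|pos] := posnP (N.+1 - 2 * s - k).
  by rewrite bin_small //; lia.
rewrite -(@leq_pmul2l (k.+1 ^ 2)) // -expnMn mul_bin_left.
rewrite -mulnn mulnACA !mul_bin_left mulnACA expnMn leq_mul //.
nia.
Qed.

(** Chebyshev's inequality, scaled by the number [c] of draws to stay in the integers. With [X] the
    number of avoided sets [I u], each draw in [Z] has [X = 0] and adds [(|V| a)^2] to the sum of
    [(c X - |V| a)^2]. *)
Lemma second_moment_bound :
  #|[set A : {set T} | [forall u, ~~ [disjoint A & I u]] & #|A| == m]|
    * (#|V| * 'C(#|T| - s, m)) <= 'C(#|T|, m) ^ 2.
Proof.
set a := 'C(#|T| - s, m); set c := 'C(#|T|, m).
pose b := 'C(#|T|.+1 - 2 * s, m).
pose Om := [set A : {set T} | #|A| == m].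
pose X (A : {set T}) := \sum_u [disjoint A & I u].
set Z := [set A | _ & _].
have count (S : {set T}) :
    \sum_(A in Om) [disjoint A & S] = 'C(#|T| - #|S|, m).
  rewrite -card_draws_disjoint -big_mkcondr sum1_card; apply: eq_card => A.
  by rewrite unfold_in !inE andbC.
have cOm : #|Om| = c.
  rewrite /c -cardsT -cards_draws; apply: eq_card => A.
  by rewrite !inE subsetT.
have EX : \sum_(A in Om) X A = #|V| * a.
  rewrite exchange_big /= -sum_nat_const; apply: eq_bigr => u _.
  by rewrite count card_I.
(* Diagonal pairs give [|V| a]; for [u != v] the union has at least [2s - 1] elements, whence
   [b]. *)
have EX2 : \sum_(A in Om) X A ^ 2 <= #|V| * a + #|V| ^ 2 * b.
  have -> : \sum_(A in Om) X A ^ 2 =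
      \sum_u \sum_v 'C(#|T| - #|I u :|: I v|, m).
    rewrite (eq_bigr (fun A : {set T} => \sum_u \sum_v [disjoint A & I u :|: I v])).
      rewrite exchange_big /=; apply: eq_bigr => u _.
      by rewrite exchange_big /=; apply: eq_bigr => v _; rewrite count.
    move=> A _; rewrite -mulnn big_distrlr /=; apply: eq_bigr => u _.
    apply: eq_bigr => v _; rewrite mulnb; congr (nat_of_bool _).
    by rewrite !disjoints_subset setCU subsetI.
  rewrite -mulnn -mulnA -mulnDr -sum_nat_const; apply: leq_sum => u _.
  rewrite (bigD1 u) //= setUid card_I leq_add2l.
  apply: (@leq_trans (\sum_(v | v != u) b)).
    apply: leq_sum => v vu; apply: leq_bin2l.
    have := card_IU vu; rewrite setUC; move: #|T| #|_ :|: _| => t x; lia.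
  by rewrite sum_nat_cond_const leq_mul // max_card.
have bc : b * c <= a ^ 2 by apply: bin_log_concave.
have variance : (\sum_(A in Om) (c%:Z * (X A)%:Z - (#|V| * a)%:Z) ^+ 2 =
    c%:Z ^+ 2 * (\sum_(A in Om) X A ^ 2)%:Z - c%:Z * (#|V| * a)%:Z ^+ 2)%R.
  have -> : (\sum_(A in Om) (c%:Z * (X A)%:Z - (#|V| * a)%:Z) ^+ 2 =
     c%:Z ^+ 2 * \sum_(A in Om) (X A ^ 2)%:Z
     - 2 * c%:Z * (#|V| * a)%:Z * \sum_(A in Om) (X A)%:Z
     + \sum_(A in Om) (#|V| * a)%:Z ^+ 2)%R.
    rewrite !big_distrr /= -sumrB -big_split /=; apply: eq_bigr => A _.
    by rewrite -mulnn PoszM; ring.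
  rewrite sumr_const cOm -!(big_morph Posz PoszD (erefl _)) EX -mulr_natl; ring.
have lower : (#|Z|%:Z * (#|V| * a)%:Z ^+ 2 <=
    \sum_(A in Om) (c%:Z * (X A)%:Z - (#|V| * a)%:Z) ^+ 2)%R.
  rewrite -[#|Z|%:Z%R]natz mulr_natl -sumr_const [leRHS](bigID [in Z]) /=.
  apply: ler_wpDr; first by apply: sumr_ge0 => A _; apply: sqr_ge0.
  rewrite le_eqVlt; apply/orP; left; apply/eqP.
  apply: eq_big => [A|A]; rewrite !inE; first by case: eqP; rewrite ?andbF.
  move=> /andP[/forallP ZA _]; rewrite /X big1 ?mulr0 ?sub0r ?sqrrN //.
  by move=> u _; rewrite (negbTE (ZA u)).
have [-> |Va] := posnP (#|V| * a); first by rewrite muln0.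
rewrite -(@leq_pmul2r (#|V| * a)) //.
move: lower; rewrite variance => lower.
have key : #|Z| * (#|V| * a) ^ 2 + c * (#|V| * a) ^ 2
    <= c ^ 2 * (#|V| * a + #|V| ^ 2 * b).
  apply: leq_trans (leq_mul (leqnn (c ^ 2)) EX2).
  move: lower; move: (\sum_(A in Om) X A ^ 2) => x.
  have sq k : ((k ^ 2)%N%:Z = k%:Z ^+ 2)%R by rewrite expr2 -PoszM mulnn.
  by rewrite -lez_nat PoszD 3!PoszM !sq lerBrDr.
(* [b c <= a^2] cancels the off-diagonal part of the second moment against the squared mean, leaving
   [c^2 |V| a]. *)
have := leq_mul (leqnn (c * #|V| ^ 2)) bc.
have -> : c * #|V| ^ 2 * (b * c) = c ^ 2 * (#|V| ^ 2 * b) by ring.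
have -> : c * #|V| ^ 2 * a ^ 2 = c * (#|V| * a) ^ 2 by ring.
rewrite mulnDr in key => h; rewrite -mulnA mulnn.
by move: (leq_trans key (leq_add (leqnn _) h)); rewrite leq_add2r.
Qed.

End SecondMoment.

(** * Union bound over small subsets *)

Section UnionBound.
Variable T : finType.

Lemma card_draws_between (S D : {set T}) m : #|S| <= m -> [disjoint S & D] ->
  #|[set A : {set T} | (S \subset A) && [disjoint A & D] & #|A| == m]|
    <= 'C(#|T| - #|S| - #|D|, m - #|S|).
Proof.
move=> Sm dSD.
have -> : #|T| - #|S| - #|D| = #|~: (S :|: D)|.
  have := cardsC (S :|: D).
  by rewrite cardsU disjoint_setI0 // cards0 subn0 -subnDA => <-; rewrite addKn.
rewrite -cards_draws -(card_in_imset (f := fun A => A :\: S)) => [|A A'].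
  apply/subset_leq_card/subsetP => _ /imsetP[A + ->].
  rewrite !inE => /andP[/andP[SA dAD] /eqP cA].
  rewrite cardsD (setIidPr SA) cA eqxx andbT setCU setDE setIC setIS //.
  by rewrite -disjoints_subset.
rewrite !inE => /andP[/andP[SA _] _] /andP[/andP[SA' _] _] E.
by rewrite -(setID A S) -(setID A' S) (setIidPr SA) (setIidPr SA') E.
Qed.

(** The quotient of the binomials is a product of factors [(M - b - i) / (M - i) <= 15/16]. *)
Lemma bin_sub_leq M b j : M <= 16 * b ->
  16 ^ j * 'C(M - b, j) <= 15 ^ j * 'C(M, j).
Proof.
move=> Mb; elim: j => [|j IH]; first by rewrite !bin0.
rewrite -(@leq_pmul2l j.+1) // !(mulnCA j.+1) !mul_bin_left.
rewrite !expnS ![_ * _ ^ j * _]mulnACA leq_mul //; lia.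
Qed.

Lemma mul_bin_trinomial N m k : k <= m -> m <= N ->
  'C(N, k) * 'C(N - k, m - k) = 'C(N, m) * 'C(m, k).
Proof.
move=> km mN.
have f : 0 < k`! * ((m - k)`! * (N - m)`!) by rewrite !muln_gt0 !fact_gt0.
apply/eqP; rewrite -(eqn_pmul2r f); apply/eqP.
have h : m - k <= N - k by lia.
have := bin_fact h; rewrite (_ : N - k - (m - k) = N - m); last by lia.
have := bin_fact km; have := bin_fact mN; have := bin_fact (leq_trans km mN).
move=> e1 e2 e3 e4.
transitivity N`!.
  by rewrite -e1 -e4; ring.
by rewrite -e2 -e3; ring.
Qed.

(** With [N = |T|], each [S] of size [k] accounts for at most [(15/16)^(m-k) 'C(N-k, m-k)] draws.
    After weighting, the trinomial identity turns the sum over [S] into the binomial expansion of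
    [(15/16 + 1/32)^m]. *)
Lemma union_bound (F : realFieldType) (E : pred {set T})
    (B : {set T} -> {set T}) (K m : nat) : m <= #|T| ->
  (forall S, E S -> [disjoint S & B S] /\ #|T| <= 16 * #|B S|) ->
  (#|[set A : {set T} | [exists S : {set T},
      [&& S \subset A, (#|S| <= K)%N, E S & [disjoint A & B S]]] & #|A| == m]|%:R
    <= 'C(#|T|, m)%:R * (32 ^+ K * (31 / 32) ^+ m) :> F)%R.
Proof.
move=> mT EB; set bad := [set A | _ & _].
(* For k <= K the weight 32^K (1/32)^k is at least 1; it turns the truncated
   binomial sum into a full one. *)
pose h k : F := ((15 / 16) ^+ (m - k) * (1 / 32) ^+ k * 'C(#|T| - k, m - k)%:R)%R.
have h0 k : (0 <= h k)%R.
  by rewrite /h !mulr_ge0 ?ler0n // exprn_ge0 //; lra.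
pose sup (S : {set T}) :=
  [set A : {set T} | (S \subset A) && [disjoint A & B S] & #|A| == m].
have supE S : E S -> #|S| <= K -> #|S| <= m -> (#|sup S|%:R <= 32 ^+ K * h #|S|)%R.
  move=> ES SK Sm; have [dS cB] := EB S ES.
  have c1 := card_draws_between Sm dS.
  have Mb : #|T| - #|S| <= 16 * #|B S| by lia.
  have c2 := bin_sub_leq (m - #|S|) Mb.
  have c3 : 16 ^ (m - #|S|) * #|sup S| <= 15 ^ (m - #|S|) * 'C(#|T| - #|S|, m - #|S|).
    by apply: leq_trans c2; rewrite leq_mul2l c1 orbT.
  rewrite -(ler_nat F) !natrM !natrX in c3.
  rewrite /h -!mulrA mulrCA.
  have one : (1 <= 32 ^+ K * (1 / 32) ^+ #|S| :> F)%R.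
    rewrite -(subnK SK) exprD -mulrA -exprMn mulrC.
    rewrite (_ : 32 * (1 / 32) = 1 :> F)%R; last by lra.
    by rewrite expr1n mul1r exprn_ege1 // ler1n.
  have step : (#|sup S|%:R <=
      (15 / 16) ^+ (m - #|S|) * 'C(#|T| - #|S|, m - #|S|)%:R :> F)%R.
    rewrite expr_div_n mulrAC ler_pdivlMr ?exprn_gt0 //.
    by rewrite mulrC.
  apply: le_trans step _; apply: ler_wpM2l; first by rewrite exprn_ge0 //; lra.
  by rewrite mulrA ler_peMl.
have badS : (#|bad|%:R <=
    \sum_(S : {set T} | [&& E S, (#|S| <= K)%N & (#|S| <= m)%N]) #|sup S|%:R :> F)%R.
  rewrite -natr_sum ler_nat.
  apply: (@leq_trans #|\bigcup_(S | [&& E S, #|S| <= K & #|S| <= m]) sup S|).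
    apply/subset_leq_card/subsetP => A; rewrite inE.
    move=> /andP[/existsP[S /and4P[SA SK ES dA]] /eqP cA].
    apply/bigcupP; exists S.
      by rewrite ES SK -cA subset_leq_card.
    by rewrite !inE SA dA cA eqxx.
  elim/big_rec2: _ => [|S x U _ IH]; first by rewrite cards0.
  by apply: leq_trans (leq_card_setU _ _) _; rewrite leq_add2l.
apply: le_trans badS _.
apply: (@le_trans _ _ (\sum_(S : {set T} | (#|S| < m.+1)%N) 32 ^+ K * h #|S|)%R).
  rewrite big_mkcond [leRHS]big_mkcond /=; apply: ler_sum => S _.
  case: ifP => [/and3P[ES SK Sm]|_]; first by rewrite ltnS Sm supE.
  by case: ifP => // _; rewrite mulr_ge0 // exprn_ge0.
rewrite -big_distrr /= mulrCA ler_wpM2l ?exprn_ge0 //.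
rewrite (partition_big (fun S : {set T} => inord #|S| : 'I_m.+1) xpredT) //=.
rewrite (_ : 31 / 32 = 15 / 16 + 1 / 32 :> F)%R; last by lra.
rewrite exprDn big_distrr /=; apply: ler_sum => k _.
rewrite (eq_bigr (fun=> h k)) => [|S /andP[Sm /eqP <-]]; last by rewrite inordK.
rewrite (eq_bigl [in [set S : {set T} | (S \subset [set: T]) && (#|S| == k)]]);
  last first.
  move=> S; rewrite !inE subsetT /= -val_eqE /=.
  have [Sm|Sm] := ltnP #|S| m.+1; first by rewrite inordK.
  by apply/esym/gtn_eqF/(leq_trans (ltn_ord k)).
rewrite sumr_const cards_draws cardsT -[leLHS]mulr_natl /h.
rewrite -[((_ ^+ _ * _ ^+ _) *+ _)%R]mulr_natl [leRHS]mulrA -natrM.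
rewrite -mul_bin_trinomial // ?natrM; last by rewrite -ltnS.
by rewrite le_eqVlt; apply/orP; left; apply/eqP; ring.
Qed.

End UnionBound.

(** * Isolated vertices *)

Section Incidence.
Variable V : finType.
Implicit Types u v : V.

Definition incident u : graph V := [set e | u \in ends e].

Lemma card_incident u : #|incident u| = #|V|.-1.
Proof.
rewrite -(card_imset _ (@val_inj _ _ (edge V))) -(cardsC1 u).
rewrite -(card_in_imset (f := fun v => [set u; v])) => [|v w].
  apply: eq_card => S; apply/imsetP/imsetP => [[e + ->]|[v + ->]].
    rewrite inE => ue; have /cards2P[x [y [xy E]]] := valP e.
    rewrite /= E in ue *; move: ue; rewrite !inE => /orP[]/eqP uE; rewrite uE.
      by exists y; rewrite // !inE eq_sym.
    by exists x; [rewrite !inE | apply: setUC].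
  rewrite !inE eq_sym => uv; have c2 : #|[set u; v]| == 2 by rewrite cards2 uv.
  by exists (Edge c2); rewrite // in_set /= set21.
rewrite !inE => vu wu /setP/(_ v); rewrite !inE eqxx orbT (negbTE vu) /=.
by move=> /esym/eqP.
Qed.

(** Two distinct vertices share at most one edge. *)
Lemma card_incidentU u v : u != v ->
  2 * #|V|.-1 <= #|incident u :|: incident v|.+1.
Proof.
move=> uv; rewrite cardsU !card_incident.
suff : #|incident u :&: incident v| <= 1 by lia.
apply/card_le1_eqP => e e'; rewrite !inE.
suff ends_uv (f : edge V) : (u \in ends f) && (v \in ends f) -> ends f = [set u; v].
  by move=> /ends_uv E /ends_uv E'; apply: val_inj; rewrite /= E E'.
move=> /andP[uf vf]; apply/esym/eqP; rewrite eqEcard cards2 uv (eqP (valP f)) /=.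
by rewrite andbT; apply/subsetP => x; rewrite !inE => /orP[]/eqP->.
Qed.

Lemma min_degree_incident (A : graph V) u :
  min_degree_ge 2 A -> ~~ [disjoint A & incident u].
Proof.
move=> /forallP/(_ u) deg2.
have /card_gt0P[v] : 0 < degree A u by apply: leq_trans deg2.
rewrite inE => /existsP[e /andP[eA /eqP ee]].
by apply/pred0Pn; exists e; rewrite !inE /= eA ee !inE eqxx.
Qed.

End Incidence.

(** Minimum degree 2 excludes isolated vertices, so the second moment bound applies with
    [I = incident] and [s = n - 1]. *)
Lemma min_degree_prob (F : realFieldType) n m : 1 < n -> m <= 'C(n, 2) ->
  (equiprob F (fun w : ordering n => min_degree_ge 2 (process w m))
   * (n%:R * 'C('C(n, 2) - n.-1, m)%:R) <= 'C('C(n, 2), m)%:R)%R.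
Proof.
move=> n1 mN; rewrite equiprob_process // mulrAC ler_pdivrMr; last first.
  by rewrite ltr0n bin_gt0.
have cE : #|{: edge 'I_n}| = 'C(n, 2) by rewrite card_edge card_ord.
have bound := @second_moment_bound _ 'I_n (@incident 'I_n) n.-1 m.
rewrite cE card_ord in bound.
rewrite -!natrM ler_nat; apply: leq_trans (bound _ _ _) => [|u|u v uv|].
- rewrite leq_mul2r; apply/orP; right; apply/subset_leq_card/subsetP => A.
  rewrite !inE => /andP[dA ->]; rewrite andbT.
  by apply/forallP => u; apply: min_degree_incident.
- by rewrite card_incident card_ord.
- by have := card_incidentU uv; rewrite card_ord.
- have := mul_bin_diag n 1; rewrite bin1; nia.
Qed.

(** * Rules for uniform probability *)

Section Equiprob.
Variables (F : realFieldType) (T : finType).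
Implicit Types P Q : pred T.
Local Open Scope ring_scope.

Lemma equiprob_ge0 P : 0 <= equiprob F P.
Proof. by rewrite divr_ge0. Qed.

Lemma sub_equiprob P Q : subpred P Q -> equiprob F P <= equiprob F Q.
Proof.
move=> PQ; rewrite ler_wpM2r ?invr_ge0 // ler_nat.
by apply/subset_leq_card/subsetP => x; apply: PQ.
Qed.

Lemma equiprobU P Q :
  equiprob F (fun x => P x || Q x) <= equiprob F P + equiprob F Q.
Proof.
rewrite -mulrDl ler_wpM2r ?invr_ge0 // -natrD ler_nat.
by rewrite -cardUI; apply: leq_trans (leq_addr _ _); apply/eq_leq/eq_card.
Qed.

Lemma equiprob_has (I : Type) (s : seq I) (P : I -> pred T) :
  equiprob F (fun x => has (P^~ x) s) <= \sum_(i <- s) equiprob F (P i).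
Proof.
elim: s => [|i s IH]; first by rewrite big_nil /equiprob eq_card0 ?mul0r.
rewrite big_cons; apply: le_trans (equiprobU _ _) _.
by rewrite lerD2l.
Qed.

Lemma equiprobC P : (0 < #|T|)%N ->
  equiprob F P = 1 - equiprob F (fun x => ~~ P x).
Proof.
move=> T0; apply/eqP; rewrite eq_sym subr_eq -mulrDl -natrD.
have -> : #|fun x : T => ~~ P x| = #|predC P| by apply: eq_card.
by rewrite cardC divff // pnatr_eq0 -lt0n.
Qed.

End Equiprob.

Lemma sub_min_degree (V : finType) d (A B : graph V) : A \subset B ->
  min_degree_ge d A -> min_degree_ge d B.
Proof.
move=> sAB /forallP dA; apply/forallP => v; apply: leq_trans (dA v) _.
apply/subset_leq_card/subsetP => u; rewrite !inE; exact: sub_adj.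
Qed.

(** * Failure events at fixed times and at the hitting time *)

Section BadEvents.
Variable F : realFieldType.

Lemma expander_expanding n (Gamma : graph 'I_n) :
  expander (n%:R / 4 : F)%R 2%R Gamma -> expanding Gamma.
Proof.
move=> /forallP ex U; rewrite card_ord => small; have /implyP := ex U.
rewrite ler_pdivlMr // -!natrM !ler_nat; apply.
by rewrite mulnC.
Qed.

(** The failure event for an edge budget [K], grouped in the shape that [union_bound] expects. *)
Definition boosterless n K (A : graph 'I_n) : bool :=
  [exists Gamma : graph 'I_n, [&& Gamma \subset A, #|Gamma| <= K,
    expander (n%:R / 4 : F)%R 2%R Gamma && ~~ hamiltonian Gamma
    & [disjoint A & [set e | booster Gamma e]]]].

Lemma boosterless_prob n K m : 9 < n -> m <= 'C(n, 2) ->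
  (equiprob F (fun w : ordering n => boosterless K (process w m))
    <= 32 ^+ K * (31 / 32) ^+ m)%R.
Proof.
move=> n9 mN; rewrite equiprob_process // ler_pdivrMr; last first.
  by rewrite ltr0n bin_gt0.
have cE : #|{: edge 'I_n}| = 'C(n, 2) by rewrite card_edge card_ord.
rewrite mulrC -cE; apply: (union_bound F K _) => [|S]; first by rewrite cE.
move=> /andP[/expander_expanding ex nH]; split.
  by apply/pred0P => e; rewrite !inE /= /booster; case: (e \in S).
have n9' : 9 < #|'I_n| by rewrite card_ord.
(* [2N = n(n-1) <= n^2 <= 32 |B|] for the set [B] of boosters. *)
rewrite -(@leq_pmul2l 2) // mulnA; apply: leq_trans (card_boosters n9' ex nH).
by rewrite cE card_ord -mulnn -(mul_bin_diag n 1) bin1 leq_mul2l leq_pred orbT.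
Qed.

(** Trades the random time for fixed ones: by monotonicity an early hit leaves minimum degree 2 at
    [m0], and otherwise the failure is seen at some time from [m0] to [N]. *)
Lemma hitting_time_dichotomy n K m0 (w : ordering n) : m0 <= 'C(n, 2) ->
  boosterless K (process w (hitting_time (min_degree_ge 2) w)) ->
  min_degree_ge 2 (process w m0) ||
  has (fun m => boosterless K (process w m)) (index_iota m0 'C(n, 2).+1).
Proof.
move=> m0N; set tau := hitting_time _ w; have [lt|ge] := ltnP tau m0.
  move=> _; apply/orP; left; apply: sub_min_degree (sub_process w (ltnW lt)) _.
  have tauN : tau < 'C(n, 2).+1 by rewrite (leq_trans lt) // ltnW.
  have hs : has (fun i => min_degree_ge 2 (process w i)) (iota 0 'C(n, 2).+1).
    by rewrite has_find size_iota.
  by have := nth_find 0 hs; rewrite nth_iota.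
(* The hitting time may be [N + 1]; the process is constant from [N] on, so it can be capped
   there. *)
move=> bad; apply/orP; right; apply/hasP; exists (minn tau 'C(n, 2)).
  by rewrite mem_index_iota leq_min ge m0N ltnS geq_minr.
suff -> : process w (minn tau 'C(n, 2)) = process w tau by [].
rewrite /minn; case: ltnP => // ltN.
by rewrite /process !take_oversize ?size_tuple.
Qed.

Lemma boosterless_hitting_prob n K m0 : 9 < n -> m0 <= 'C(n, 2) ->
  (equiprob F (fun w : ordering n =>
     boosterless K (process w (hitting_time (min_degree_ge 2) w)))
   <= equiprob F (fun w : ordering n => min_degree_ge 2 (process w m0))
      + \sum_(m0 <= m < 'C(n, 2).+1) 32 ^+ K * (31 / 32) ^+ m)%R.
Proof.
move=> n9 m0N; apply: le_trans (sub_equiprob _ _) _.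
  by move=> w; apply: hitting_time_dichotomy m0N.
apply: le_trans (equiprobU _ _ _) _; rewrite lerD2l.
apply: le_trans (equiprob_has _ _ _) _.
rewrite big_nat [leRHS]big_nat; apply: ler_sum => m /andP[_ mN].
exact: boosterless_prob.
Qed.

(** * Numerical bounds *)

Local Open Scope ring_scope.

Lemma bernoulli_ineq (x : F) k : 0 <= x -> 1 + k%:R * x <= (1 + x) ^+ k.
Proof.
move=> x0; elim: k => [|k IH]; first by rewrite mul0r addr0 expr0.
rewrite exprS -natr1; apply: le_trans (ler_wpM2l _ IH); last by lra.
have : 0 <= k%:R * x ^+ 2 by rewrite mulr_ge0 ?sqr_ge0.
by nra.
Qed.

Lemma geometric_tail (a d : nat) :
  \sum_(a <= m < a + d) (63 / 64 : F) ^+ m <= 64 * (63 / 64) ^+ a.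
Proof.
suff -> : \sum_(a <= m < a + d) (63 / 64 : F) ^+ m =
    64 * (63 / 64) ^+ a - 64 * (63 / 64) ^+ (a + d).
  by rewrite gerBl mulr_ge0 // exprn_ge0 //; lra.
elim: d => [|d IH]; first by rewrite addn0 big_geq // subrr.
by rewrite addnS big_nat_recr ?leq_addr //= IH exprS; lra.
Qed.

(** By Bernoulli [(63/62)^62 >= 2], so with [310 = 62 * 5] one has
    [32^K <= (63/62)^(310 K) <= (63/62)^m]; and [(63/62) (31/32) = 63/64]. *)
Lemma boosterless_tail K N :
  \sum_(310 * K <= m < N) 32 ^+ K * (31 / 32 : F) ^+ m
    <= 64 * (63 / 64) ^+ (310 * K).
Proof.
have [le|lt] := leqP (310 * K) N; last first.
  by rewrite big_geq 1?ltnW // mulr_ge0 // exprn_ge0 //; lra.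
apply: le_trans (geometric_tail _ (N - 310 * K)).
rewrite (subnKC le) big_nat [leRHS]big_nat; apply: ler_sum => m /andP[Km _].
rewrite (_ : 63 / 64 = (63 / 62) * (31 / 32)); last by lra.
rewrite [leRHS]exprMn ler_wpM2r ?exprn_ge0 //; first by lra.
have e1 : 1 <= 63 / 62 :> F by lra.
apply: le_trans (ler_weXn2l e1 Km); rewrite exprM.
apply: lerXn2r; rewrite ?nnegrE ?exprn_ge0 //; first by lra.
rewrite (_ : 310 = 62 * 5)%N // exprM (_ : 32 = 2 ^+ 5); last by ring.
apply: lerXn2r; rewrite ?nnegrE ?exprn_ge0 //; first by lra.
rewrite (_ : 63 / 62 = 1 + 62^-1); last by lra.
apply: le_trans (bernoulli_ineq _ _); last by rewrite invr_ge0.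
by rewrite divff ?pnatr_eq0 //; lra.
Qed.

(** The quotient is a product over [j < m] of factors [1 - s / (N - j) >= q]. *)
Lemma bin_sub_geq N s m (q : F) : 0 <= q <= 1 ->
  s%:R <= (1 - q) * (N - m)%:R -> q ^+ m * 'C(N, m)%:R <= 'C(N - s, m)%:R.
Proof.
move=> /andP[q0 q1] hs.
suff: forall j, (j <= m)%N -> q ^+ j * 'C(N, j)%:R <= 'C(N - s, j)%:R by apply.
elim=> [|j IH] jm; first by rewrite !bin0 mulr1.
rewrite -(@ler_pM2l _ j.+1%:R) ?ltr0n // mulrCA -!natrM !mul_bin_left !natrM.
rewrite exprS mulrACA; apply: ler_pM => //; rewrite ?mulr_ge0 ?exprn_ge0 //.
  have h1 : (N - j)%:R <= (N - s - j)%:R + s%:R :> F by rewrite -natrD ler_nat; lia.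
  have h2 : (1 - q) * (N - m)%:R <= (1 - q) * (N - j)%:R.
    by rewrite ler_wpM2l ?subr_ge0 // ler_nat; lia.
  by move: hs h1 h2; rewrite !mulrBl !mul1r; lra.
by apply: IH; lia.
Qed.

End BadEvents.

(** * Asymptotics *)

From mathcomp Require Import all_classical all_reals all_analysis.

Import numFieldNormedType.Exports.

Local Open Scope classical_set_scope.
Local Open Scope ring_scope.

(** [1 / (1 - x) <= 1 + 2x <= exp(2x)] on this range. *)
Lemma expR_le_1B (R : realType) (x : R) : 0 <= x <= 1 / 2 ->
  expR (- (2 * x)) <= 1 - x.
Proof.
move=> /andP[x0 x1]; rewrite expRN -[leRHS]invrK lef_pV2 ?posrE ?expR_gt0 //;
  last by rewrite invr_gt0; lra.
apply: le_trans (expR_ge1Dx (2 * x)); rewrite invf_ple ?posrE; try lra.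
rewrite -div1r ler_pdivrMr; last by lra.
by nra.
Qed.

Lemma natr_bin2 (R : realType) n : (0 < n)%N ->
  2 * 'C(n, 2)%:R = n%:R * (n%:R - 1) :> R.
Proof.
move=> n0; have := mul_bin_diag n 1; rewrite bin1 => /(congr1 (GRing.natmul 1)).
move=> /(_ R); rewrite !natrM => <-; congr (_ * _).
by rewrite -subn1 natrB.
Qed.

Lemma ln_le_B1 (R : realType) (x : R) : 0 < x -> ln x <= x - 1.
Proof. by move=> x0; rewrite -{1}(subrKC 1 x) le_ln1Dx //; lra. Qed.

Section Estimates.
Variables (R : realType) (n m : nat).
Hypothesis n9 : (9 < n)%N.
Hypothesis m_le : m%:R <= n%:R * ln n%:R / 16 :> R.

Lemma early_le_half : 2 * m%:R <= 'C(n, 2)%:R :> R.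
Proof.
have h1 : n%:R * ln n%:R <= n%:R * (n%:R - 1) :> R.
  by rewrite ler_wpM2l // ln_le_B1 // ltr0n; lia.
have := natr_bin2 R (ltn_trans (isT : (0 < 9)%N) n9).
have := ler0n R 'C(n, 2); have := m_le; lra.
Qed.

Lemma early_le : (m <= 'C(n, 2))%N.
Proof.
have := early_le_half; rewrite -natrM ler_nat; lia.
Qed.

Lemma early_min_degree_prob :
  equiprob R (fun w : ordering n => min_degree_ge 2 (process w m))
    <= expR (- (ln n%:R / 2)).
Proof.
set p := equiprob _ _.
have p0 : 0 <= p by apply: equiprob_ge0.
have c0 : 0 < 'C('C(n, 2), m)%:R :> R by rewrite ltr0n bin_gt0 early_le.
(* Since [N - m >= N/2], one has [n - 1 <= (4/n) (N - m)], as [bin_sub_geq] requires. Then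
   [q^m >= exp(-8m/n) >= n^(-1/2)]. *)
pose q : R := 1 - 4 / n%:R.
have n10 : 10 <= n%:R :> R by rewrite ler_nat.
have n0 : 0 < n%:R :> R by lra.
have n4 : 4 / n%:R <= 1 / 2 :> R by rewrite ler_pdivrMr //; lra.
have n40 : 0 <= 4 / n%:R :> R by rewrite divr_ge0.
have bin_q : q ^+ m * 'C('C(n, 2), m)%:R <= 'C('C(n, 2) - n.-1, m)%:R.
  apply: bin_sub_geq; first by apply/andP; split; rewrite /q; lra.
  rewrite /q opprB addrC subrK natrB ?early_le // mulrAC ler_pdivlMr //.
  rewrite -subn1 natrB; last by lia.
  have := natr_bin2 R (ltn_trans (isT : (0 < 9)%N) n9); have := early_le_half; lra.
have exp_q : expR (- (ln n%:R / 2)) <= q ^+ m.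
  apply: (@le_trans _ _ (expR (- (2 * (4 / n%:R))) ^+ m)); last first.
    apply: lerXn2r; rewrite ?nnegrE ?expR_ge0 //; first by rewrite /q; lra.
    by apply: expR_le_1B; rewrite n40.
  rewrite -expRM_natl ler_expR mulrN lerN2.
  have -> : m%:R * (2 * (4 / n%:R)) = 8 * m%:R / n%:R :> R by ring.
  by rewrite ler_pdivrMr //; have := m_le; lra.
have pn : p * (n%:R * expR (- (ln n%:R / 2))) <= 1.
  rewrite -(ler_pM2r c0) mul1r.
  have := min_degree_prob R (ltn_trans (isT : (1 < 9)%N) n9) early_le.
  rewrite -/p; apply: le_trans; rewrite -mulrA ler_wpM2l // -mulrA.
  apply: ler_wpM2l => //.
  apply: le_trans (ler_wpM2r (ltW c0) exp_q) bin_q.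
have nE : n%:R * expR (- (ln n%:R / 2)) = expR (ln n%:R / 2) :> R.
  rewrite -{1}(@lnK R n%:R) ?posrE // -expRD; congr expR; lra.
by rewrite nE expRN in pn *; rewrite -div1r ler_pdivlMr ?expR_gt0.
Qed.

End Estimates.

Lemma boosterless_hitting_le (R : realType) n K : (9 < n)%N ->
  (310 * K)%:R <= n%:R * ln n%:R / 16 :> R ->
  equiprob R (fun w : ordering n =>
    boosterless R K (process w (hitting_time (min_degree_ge 2) w)))
  <= expR (- (ln n%:R / 2)) + 64 * (63 / 64) ^+ (310 * K).
Proof.
move=> n9 mle.
apply: le_trans (boosterless_hitting_prob R K n9 (early_le n9 mle)) _.
by rewrite lerD ?early_min_degree_prob ?boosterless_tail.
Qed.

Theorem lemma4p7 (R : realType) :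
  exists2 delta : R, 0 < delta & forall delta0 : R, 0 < delta0 <= delta ->
    (fun n : nat =>
       let d0 : int := Num.floor (delta0 * ln (n%:R : R)) in
       equiprob R (fun w : ordering n =>
         let G := process w (hitting_time (min_degree_ge 2) w) in
         [forall Gamma : graph 'I_n,
            [&& Gamma \subset G, expander (n%:R / 4 : R) 2 Gamma
              & #|Gamma|%:Z <= d0 * n%:Z + n%:Z] ==>
            hamiltonian Gamma || [exists e in G, booster Gamma e]]))
    @ \oo --> (1 : R).
Proof.
(* Half of the rate [1 / (310 * 16)] of the budget [x] below; the other half absorbs the extra [n]
   edges once [ln n >= 620 * 16]. *)
pose delta : R := 1 / 620 / 16.
exists delta => [|delta0 /andP[d0_gt0 d0_le]]; first by rewrite /delta; lra.
apply/cvgrPdist_le => eps eps0.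
have ln_ge (c : R) : \forall n \near \oo, c <= ln (n%:R : R).
  near=> n.
  have h : expR c <= n%:R by near: n; exact: nbhs_infty_ger.
  have n0 : 0 < n%:R :> R by apply: lt_le_trans h; apply: expR_gt0.
  by rewrite -[c]expRK ler_ln // posrE ?expR_gt0.
have geo : \forall n \near \oo, 64 * (63 / 64 : R) ^+ n <= eps / 2.
  have e0 : 0 < eps / 128 by lra.
  have lt1 : `|63 / 64 : R| < 1 by rewrite ger0_norm; lra.
  have /cvgrPdist_le/(_ _ e0) := cvg_expr lt1.
  apply: filterS => n /=; rewrite sub0r normrN ger0_norm ?exprn_ge0; lra.
near=> n => /=.
have n9 : (9 < n)%N by near: n; exact: nbhs_infty_gt.
have ln1 : 620 * 16 <= ln (n%:R : R) by near: n; exact: ln_ge.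
have lne : - 2 * ln (eps / 2) <= ln (n%:R : R) by near: n; exact: ln_ge.
have geon : 64 * (63 / 64 : R) ^+ n <= eps / 2 by near: n.
have n0 : 10 <= n%:R :> R by rewrite ler_nat.
(* Chosen so that [310 x = n ln n / 16], the latest time covered by the isolated-vertex estimate. *)
pose x : R := n%:R * ln n%:R / 310 / 16.
have l0 : 0 <= ln (n%:R : R) by lra.
have nl0 : 0 <= n%:R * ln n%:R :> R by rewrite mulr_ge0.
have x0 : 0 <= x by rewrite /x; lra.
pose K := Num.trunc x.
have Kx : K%:R <= x by rewrite truncn_le.
have K_ge k : k%:R <= x -> (k <= K)%N.
  by move=> /le_truncn; rewrite natrK.
(* This makes the tail [64 (63/64)^(310 K)] vanish as [n] grows. *)
have nK : (n <= K)%N by apply: K_ge; rewrite /x; nra.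
have mle : (310 * K)%:R <= n%:R * ln n%:R / 16 :> R.
  by rewrite natrM; move: Kx; rewrite /x; lra.
rewrite equiprobC ?card_ordering_gt0 // opprB addrC subrK.
rewrite ger0_norm ?equiprob_ge0 //.
apply: le_trans (_ : _ <= equiprob R (fun w : ordering n =>
    boosterless R K (process w (hitting_time (min_degree_ge 2) w)))) _.
  apply: sub_equiprob => w; rewrite negb_forall => /existsP[Gamma].
  rewrite negb_imply => /andP[/and3P[sG ex cG]].
  rewrite negb_or => /andP[nH /existsPn noB].
  apply/existsP; exists Gamma; rewrite sG ex nH /=.
  apply/andP; split; last first.
    by apply/pred0P => e /=; rewrite [X in _ && X]finset.in_set; apply/negbTE/noB.
  apply: K_ge.
  have := floor_le (delta0 * ln (n%:R : R)); set d0 := Num.floor _ in cG * => hf.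
  have : (#|Gamma|%:Z)%:~R <= (d0 * n%:Z + n%:Z)%:~R :> R by rewrite ler_int.
  rewrite intrD intrM -!pmulrn => h.
  apply: le_trans h _.
  have h1 : d0%:~R * n%:R <= delta0 * ln n%:R * n%:R by rewrite ler_wpM2r.
  have h2 : delta0 * ln n%:R * n%:R <= delta * ln n%:R * n%:R.
    by rewrite ler_wpM2r // ler_wpM2r //; lra.
  apply: le_trans (lerD (le_trans h1 h2) (lexx _)) _.
  rewrite /x /delta; nra.
apply: le_trans (boosterless_hitting_le n9 mle) _.
have e1 : expR (- (ln n%:R / 2)) <= eps / 2.
  rewrite -[leRHS]lnK ?posrE; last by lra.
  rewrite ler_expR; lra.
have e2 : 64 * (63 / 64) ^+ (310 * K) <= 64 * (63 / 64) ^+ n :> R.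
  apply: ler_wpM2l; first exact: ler0n.
  by apply: ler_wiXn2l; [lra | lra | rewrite (leq_trans nK) // leq_pmull].
by apply: le_trans (lerD e1 (le_trans e2 geon)) _; rewrite -splitr.
Unshelve. all: by end_near. Qed.
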